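(* Let $A$ be a nonempty set, $G$ a group, $F:A\to\mathcal P(G)$ a soft group, and $\tau$ a soft topology on $F$ such that $(F,\tau)$ is a soft paratopological group. Then $(F,\tau^{-1})$ is also a soft paratopological group; multiplication on $\mathrm{SE}(F)$ is continuous in both selector topologies $\tau^\ast$ and $(\tau^{-1})^\ast$, and inversion $a\mapsto a^{-1}$ is a homeomorphism $$(\mathrm{SE}(F),\tau^\ast)\longrightarrow(\mathrm{SE}(F),(\tau^{-1})^\ast).$$ Moreover, the following conditions are equivalent: (i) $(F,\tau)$ is a soft topological group, i.e. $(\mathrm{SE}(F),\ast,\tau^\ast)$ is a topological group; (ii) $(F,\tau,\tau^{-1})$ is a soft bitopological group, i.e. both $(\mathrm{SE}(F),\ast,\tau^\ast)$ and $(\mathrm{SE}(F),\ast,(\tau^{-1})^\ast)$ are topological groups; (iii) $\tau^\ast=(\tau^{-1})^\ast$. If $\tau$ is canonical, condition (iii) is also equivalent to $\tau=\tau^{-1}$.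
   Context: A soft set over $G$ with parameter set $A$ is a map $F:A\to\mathcal P(G)$; it is a soft group if every $F(t)$ is a subgroup of $G$. $\mathrm{SE}(F)=\prod_{t\in A}F(t)$ is the set of selectors $a:A\to G$ with $a(t)\in F(t)$; it is a group under $(a\ast b)(t)=a(t)b(t)$, $a^{-1}(t)=a(t)^{-1}$. A soft subset of $F$ is a map $H:A\to\mathcal P(G)$ with $H(t)\subseteq F(t)$ for all $t$; soft unions and intersections are taken parameterwise. A soft topology $\tau$ on $F$ is a family of soft subsets of $F$ containing $F$ and the empty soft set $\Phi$ ($\Phi(t)=\varnothing$ for all $t$), closed under arbitrary soft unions and finite soft intersections. Its component topology at $t$ is $\tau_t=\{H(t):H\in\tau\}$, a topology on $F(t)$. The selector (box) topology $\tau^\ast$ on $\mathrm{SE}(F)$ is the topology with base $\{\prod_{t\in A}U_t: U_t\in\tau_t\ \forall t\in A\}$. The canonical enlargement of $\tau$ is $\tau_{\mathrm{can}}=\{H \text{ soft subset of } F: H(t)\in\tau_t\ \forall t\in A\}$; $\tau$ is canonical if $\tau=\tau_{\mathrm{can}}$. $(F,\tau)$ is a soft paratopological group if multiplication $(a,b)\mapsto a\ast b$ is continuous from $\tau^\ast\times\tau^\ast$ to $\tau^\ast$. The conjugate (inverse) soft topology $\tau^{-1}$ is the canonical soft topology on $F$ whose component topology at $t$ is $\{U^{-1}:U\in\tau_t\}$, where $U^{-1}=\{x^{-1}:x\in U\}$; i.e. a soft subset $H$ of $F$ lies in $\tau^{-1}$ iff $H(t)^{-1}\in\tau_t$ for all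 $t\in A$. *)

(* Defs.v *)
From HB Require Import structures.
From mathcomp Require Import all_boot.
From mathcomp Require Import boolp classical_sets filter topology.

Set Implicit Arguments.
Unset Strict Implicit.
Unset Printing Implicit Defensive.

Local Open Scope classical_set_scope.
Local Open Scope group_scope.

#[short(type="preTopologicalGroupType")]
HB.structure Definition PreTopologicalGroup := {T of Topological T & Group T}.

Definition mul_continuous (T : preTopologicalGroupType) : Prop :=
  continuous (fun p : T * T => p.1 * p.2).

Definition inv_continuous (T : preTopologicalGroupType) : Prop :=
  continuous (fun x : T => x^-1).

Definition is_topological_group (T : preTopologicalGroupType) : Prop :=
  mul_continuous T /\ inv_continuous T.

Definition homeomorphism (S T : topologicalType) (f : S -> T) : Prop :=
  exists g : T -> S,
    [/\ cancel f g, cancel g f, continuous f & continuous g].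

Definition is_subgroup (G : groupType) (S : set G) : Prop :=
  [/\ S 1, forall x y, S x -> S y -> S (x * y) & forall x, S x -> S x^-1].

Definition set_inv (G : groupType) (U : set G) : set G :=
  [set x^-1 | x in U].

Record softGroup (A : Type) (G : groupType) := SoftGroup {
  soft_carrier :> A -> set G;
  soft_groupP : forall t, is_subgroup (soft_carrier t)
}.

Section SoftSets.
Variables (A : Type) (G : groupType).
Implicit Types (H K : A -> set G).

Definition soft_subset H K : Prop := forall t, H t `<=` K t.

Definition soft_empty : A -> set G := fun=> set0.

Definition soft_setI H K : A -> set G := fun t => H t `&` K t.

Definition soft_bigcup (C : set (A -> set G)) : A -> set G :=
  fun t => \bigcup_(H in C) H t.

End SoftSets.

(* The empty finite intersection is F, which is why binary intersections
   suffice in soft_openI. *)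
Record softTopology (A : Type) (G : groupType) (F : A -> set G) :=
  SoftTopology {
    soft_open : set (A -> set G);
    soft_open_sub : forall H, soft_open H -> soft_subset H F;
    soft_openT : soft_open F;
    soft_open0 : soft_open (@soft_empty A G);
    soft_open_bigcup : forall C, C `<=` soft_open -> soft_open (soft_bigcup C);
    soft_openI : forall H K,
      soft_open H -> soft_open K -> soft_open (soft_setI H K)
  }.

Record selector (A : Type) (G : groupType) (F : A -> set G) := Selector {
  selector_fun :> A -> G;
  selectorP : forall t, F t (selector_fun t)
}.

HB.instance Definition _ (A : Type) (G : groupType) (F : A -> set G) :=
  gen_eqMixin (selector F).
HB.instance Definition _ (A : Type) (G : groupType) (F : A -> set G) :=
  gen_choiceMixin (selector F).

Lemma selector_ext (A : Type) (G : groupType) (F : A -> set G)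
  (a b : selector F) : (forall t, a t = b t) -> a = b.
Proof.
case: a b => [a aF] [b bF] /= /funext ab; rewrite {}ab in aF *.
by congr Selector; exact: Prop_irrelevance.
Qed.

Section SelectorGroup.
Variables (A : Type) (G : groupType) (F : softGroup A G).

Fact selector_one_subproof t : F t ((fun=> 1) t).
Proof. by case: (soft_groupP F t). Qed.

Definition selector_one : selector F := Selector selector_one_subproof.

Fact selector_mul_subproof (a b : selector F) t : F t (a t * b t).
Proof.
by case: (soft_groupP F t) => _ + _; apply; [exact: selectorP|exact: selectorP].
Qed.

Definition selector_mul (a b : selector F) : selector F :=
  Selector (selector_mul_subproof a b).

Fact selector_inv_subproof (a : selector F) t : F t (a t)^-1.
Proof. by case: (soft_groupP F t) => _ _; apply; exact: selectorP. Qed.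

Definition selector_inv (a : selector F) : selector F :=
  Selector (selector_inv_subproof a).

Fact selector_mulA : associative selector_mul.
Proof. by move=> a b c; apply: selector_ext => t /=; rewrite mulgA. Qed.

Fact selector_mul1 : left_id selector_one selector_mul.
Proof. by move=> a; apply: selector_ext => t /=; rewrite mul1g. Qed.

Fact selector_mulr1 : right_id selector_one selector_mul.
Proof. by move=> a; apply: selector_ext => t /=; rewrite mulg1. Qed.

Fact selector_mulV : left_inverse selector_one selector_inv selector_mul.
Proof. by move=> a; apply: selector_ext => t /=; rewrite mulVg. Qed.

Fact selector_mulrV : right_inverse selector_one selector_inv selector_mul.
Proof. by move=> a; apply: selector_ext => t /=; rewrite mulgV. Qed.

HB.instance Definition _ := isGroup.Build (selector F)
  selector_mulA selector_mul1 selector_mulr1 selector_mulV selector_mulrV.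

End SelectorGroup.

Section Components.
Variables (A : Type) (G : groupType) (F : A -> set G) (tau : softTopology F).

Definition component (t : A) : set (set G) := [set H t | H in soft_open tau].

Lemma component_sub t U : component t U -> U `<=` F t.
Proof. by case=> H Ho <-; exact: (soft_open_sub Ho). Qed.

Lemma componentT t : component t (F t).
Proof. by exists F => //; exact: soft_openT. Qed.

Lemma component0 t : component t set0.
Proof. by exists (@soft_empty A G) => //; exact: soft_open0. Qed.

Lemma componentI t U V :
  component t U -> component t V -> component t (U `&` V).
Proof.
by case=> H Ho <- [K Ko <-]; exists (soft_setI H K) => //; exact: soft_openI.
Qed.

Lemma component_bigcup t (C : set (set G)) :
  C `<=` component t -> component t (\bigcup_(U in C) U).
Proof.
move=> Co; exists (soft_bigcup [set H | soft_open tau H /\ C (H t)]).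
  by apply: soft_open_bigcup => H [].
apply/seteqP; split=> x.
  by case=> H [Ho CH] Hx; exists (H t).
by case=> U CU Ux; have [H Ho HU] := Co _ CU; exists H; rewrite /= HU.
Qed.

Definition canonical_enlargement : set (A -> set G) :=
  [set H | soft_subset H F /\ forall t, component t (H t)].

Definition canonical_soft_topology : Prop := soft_open tau = canonical_enlargement.

Definition box (U : A -> set G) : set (selector F) :=
  [set a | forall t, U t (a t)].

Definition box_index : set (A -> set G) := [set U | forall t, component t (U t)].

Fact box_cover : \bigcup_(U in box_index) box U = setT.
Proof.
apply/seteqP; split=> // a _; exists F => [t|t]; first exact: componentT.
exact: selectorP.
Qed.

Fact box_join (U V : A -> set G) (a : selector F) :
  box_index U -> box_index V -> box U a -> box V a ->
  exists W, [/\ box_index W, box W a & box W `<=` box U `&` box V].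
Proof.
move=> oU oV Ua Va; exists (soft_setI U V); split.
- by move=> t; exact: componentI.
- by move=> t; split; [exact: Ua|exact: Va].
- by move=> b UVb; split=> t; case: (UVb t).
Qed.

End Components.

(* SE(F) carrying the selector (box) topology of tau. *)
Definition selector_space (A : Type) (G : groupType) (F : A -> set G)
    (tau : softTopology F) : Type := selector F.

HB.instance Definition _ (A : Type) (G : groupType) (F : A -> set G)
    (tau : softTopology F) := Choice.copy (selector_space tau) (selector F).
HB.instance Definition _ (A : Type) (G : groupType) (F : A -> set G)
    (tau : softTopology F) :=
  isBaseTopological.Build (selector_space tau) (box_cover tau)
    (@box_join A G F tau).

HB.instance Definition _ (A : Type) (G : groupType) (F : softGroup A G)
    (tau : softTopology F) :=
  Group.copy (selector_space tau) (selector F).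

(* The selector topology as a family of subsets of SE(F), so that the topologies
   of two soft topologies on F can be compared. *)
Definition selector_topology (A : Type) (G : groupType) (F : A -> set G)
    (tau : softTopology F) : set (set (selector F)) :=
  @open (selector_space tau).

Lemma selector_topologyE (A : Type) (G : groupType) (F : A -> set G)
    (tau : softTopology F) :
  selector_topology tau =
  [set \bigcup_(U in D) @box A G F U | D in subset^~ (box_index tau)].
Proof. by []. Qed.

Section ConjugateTopology.
Variables (A : Type) (G : groupType) (F : softGroup A G) (tau : softTopology F).

Lemma set_invE (U : set G) : set_inv U = [set x | U x^-1].
Proof.
apply/seteqP; split=> [_ [x Ux <-]|x Ux] /=; first by rewrite invgK.
by exists x^-1 => //; rewrite invgK.
Qed.

Lemma set_invK : involutive (@set_inv G).
Proof.
by move=> U; rewrite !set_invE; apply/seteqP; split=> x /=; rewrite invgK.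
Qed.

Lemma set_inv_subgroup t : set_inv (F t) = F t.
Proof.
rewrite set_invE; case: (soft_groupP F t) => _ _ FV.
by apply/seteqP; split=> x /= /FV //; rewrite invgK.
Qed.

Definition conj_open : set (A -> set G) :=
  [set H | soft_subset H F /\ forall t, component tau t (set_inv (H t))].

Fact conj_open_sub H : conj_open H -> soft_subset H F.
Proof. by case. Qed.

Fact conj_openT : conj_open F.
Proof. by split=> [t x //|t]; rewrite set_inv_subgroup; exact: componentT. Qed.

Fact conj_open0 : conj_open (@soft_empty A G).
Proof.
split=> [t x []//|t].
by rewrite /set_inv /soft_empty image_set0; exact: component0.
Qed.

Fact conj_open_bigcup C : C `<=` conj_open -> conj_open (soft_bigcup C).
Proof.
move=> Co; split=> [t x [H /Co[HF _]]|t]; first exact: HF.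
have -> : set_inv (soft_bigcup C t) =
    \bigcup_(U in [set set_inv (H t) | H in C]) U.
  apply/seteqP; split=> [_ [x [H CH Hx] <-]|x [_ [H CH <-] [y Hy <-]]].
    by exists (set_inv (H t)); [exists H|exists x].
  by exists y => //; exists H.
by apply: component_bigcup => _ [H CH <-]; have [_] := Co _ CH; apply.
Qed.

Fact conj_openI H K : conj_open H -> conj_open K -> conj_open (soft_setI H K).
Proof.
move=> [HF Ho] [KF Ko]; split=> [t x [/HF]//|t].
have -> : set_inv (soft_setI H K t) = set_inv (H t) `&` set_inv (K t).
  by rewrite !set_invE.
exact: componentI.
Qed.

Definition conj_topology : softTopology F :=
  SoftTopology conj_open_sub conj_openT conj_open0 conj_open_bigcup conj_openI.

Lemma component_conj t :
  component conj_topology t = [set set_inv U | U in component tau t].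
Proof.
apply/seteqP; split=> [_ [H [_ Ho] <-]|_ [U Uo <-]].
  by exists (set_inv (H t)) => //; exact: set_invK.
have FV s : set_inv (F s) = F s by exact: set_inv_subgroup.
exists (fun s => [set x | F s x /\ (s = t -> set_inv U x)]); last first.
  apply/seteqP; split=> x /= => [[_]|Ux]; first exact.
  split=> //; move: Ux; rewrite set_invE /= => /(component_sub Uo) Fx.
  by rewrite -FV set_invE.
split=> [s x []//|s].
have [->|st] := pselect (s = t).
  rewrite [X in component _ _ X](_ : _ = U) //.
  rewrite set_invE; apply/seteqP; split=> x /=.
    by case=> _ /(_ erefl); rewrite set_invE /= invgK.
  move=> Ux; split; last by move=> _; rewrite set_invE /= invgK.
  by have := component_sub Uo Ux; rewrite -{1}FV set_invE.
rewrite [X in component _ _ X](_ : _ = F s); first exact: componentT.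
rewrite -[RHS]FV !set_invE; apply/seteqP; split=> x /=; first by case.
by move=> Fx; split=> // /st.
Qed.

Lemma canonical_conj : canonical_soft_topology conj_topology.
Proof.
apply/seteqP; split=> H.
  move=> Ho; split; first exact: (conj_open_sub Ho).
  by move=> t; exists H.
move=> [HF Ho]; split=> // t.
by have := Ho t; rewrite component_conj => -[U Uo <-]; rewrite set_invK.
Qed.

End ConjugateTopology.

Section SoftGroups.
Variables (A : Type) (G : groupType) (F : softGroup A G).

Definition soft_paratopological_group (tau : softTopology F) : Prop :=
  mul_continuous (selector_space tau).

Definition soft_topological_group (tau : softTopology F) : Prop :=
  is_topological_group (selector_space tau).

Definition soft_bitopological_group (tau sigma : softTopology F) : Prop :=
  soft_topological_group tau /\ soft_topological_group sigma.

End SoftGroups.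

(* Main.v *)
Require Import Defs.
From HB Require Import structures.
From mathcomp Require Import all_boot.
From mathcomp Require Import boolp classical_sets filter topology.

(** Inversion maps boxes of [tau] onto boxes of [conj_topology tau], hence it is
    a homeomorphism between the two selector topologies; every continuity claim
    is transported along it, using [a * b = (b^-1 * a^-1)^-1] for products.  A set
    is conj-open iff its inverse is tau-open, so continuity of inversion for
    [tau] says exactly that the two selector topologies coincide.  Finally a
    selector topology determines the component topologies: a selector can be
    modified freely at one parameter, so a nonempty box inside the cylinder over
    [U] at [t] has its [t]-side inside [U]. *)

Set Implicit Arguments.
Unset Strict Implicit.
Unset Printing Implicit Defensive.

Local Open Scope classical_set_scope.
Local Open Scope group_scope.

Section SelectorTopology.
Variables (A : Type) (G : groupType) (F : A -> set G).
Implicit Types tau sigma : softTopology F.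

Lemma open_box tau (U : A -> set G) :
  box_index tau U -> selector_topology tau (box U).
Proof.
move=> oU; rewrite selector_topologyE; exists [set U]; last exact: bigcup_set1.
by move=> _ ->.
Qed.

Lemma selector_topologyP tau (O : set (selector F)) :
  selector_topology tau O <->
  forall a, O a -> exists U, [/\ box_index tau U, box U a & box U `<=` O].
Proof.
rewrite selector_topologyE; split=> [[D DI <-] a [U DU Ua]|H].
  by exists U; split=> //; [exact: DI | move=> b Ub; exists U].
exists [set U | box_index tau U /\ box U `<=` O]; first by move=> U [].
apply/seteqP; split=> [a [U [_ UO] Ua]|a Oa]; first exact: UO.
by have [U [oU Ua UO]] := H a Oa; exists U.
Qed.

(** Equality on the arbitrary type [A] is decided classically by [pselect]. *)
Definition override (a : selector F) (t : A) (x : G) (s : A) : G :=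
  if pselect (s = t) then x else a s.

Lemma override_selectorP (a : selector F) t x (Fx : F t x) s :
  F s (override a t x s).
Proof.
by rewrite /override; case: pselect => /= [->//|_]; exact: selectorP.
Qed.

Definition override_selector (a : selector F) t x (Fx : F t x) : selector F :=
  Selector (override_selectorP a Fx).

Lemma override_selectorE (a : selector F) t x (Fx : F t x) :
  override_selector a Fx t = x.
Proof. by rewrite /= /override; case: pselect. Qed.

Lemma box_override (U : A -> set G) (a : selector F) t x (Fx : F t x) :
  (forall s, s <> t -> U s (a s)) -> U t x -> box U (override_selector a Fx).
Proof.
by move=> Ua Ux s; rewrite /= /override; case: pselect => /= [->//|/Ua].
Qed.

(** The selector [a0] supplies values away from [t], so that every point of [F t] extends to a
    selector. *)
Lemma component_le tau sigma (a0 : selector F) t :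
  selector_topology tau `<=` selector_topology sigma ->
  component tau t `<=` component sigma t.
Proof.
move=> le_ts U oU.
(* The cylinder over [U]: it equals [U] at [t] and all of [F s] elsewhere, hence indexes a
   [tau]-box. *)
pose cyl s := [set x | F s x /\ (s = t -> U x)].
have cylt : cyl t = U.
  apply/seteqP; split=> x /= => [[_]|Ux]; first exact.
  by split=> //; exact: component_sub oU _ Ux.
have /open_box/le_ts/selector_topologyP cylO : box_index tau cyl.
  move=> s; have [->|st] := pselect (s = t); first by rewrite cylt.
  rewrite [cyl s](_ : _ = F s); first exact: componentT.
  by apply/seteqP; split=> x /=; [case | split=> // /st].
(* It suffices to cover [U] by [sigma]-component sets contained in it. *)
pose C := [set V | component sigma t V /\ V `<=` U].
suff -> : U = \bigcup_(V in C) V by apply: component_bigcup => V [].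
apply/seteqP; split=> [x Ux|x [V [_ VU] Vx]]; last exact: VU.
have Fx : F t x by exact: component_sub oU _ Ux.
have [|V [oV Va Vcyl]] := cylO (override_selector a0 Fx).
  apply: box_override => [s st|]; last by rewrite cylt.
  by split=> //; exact: selectorP.
exists (V t); last by have := Va t; rewrite override_selectorE.
split; first exact: oV.
(* Replacing the value [x] at [t] by [y] stays in [box V], hence in the cylinder, which forces [y]
   into [U]. *)
move=> y Vy; have Fy : F t y by exact: component_sub (oV t) _ Vy.
have /Vcyl/(_ t) : box V (override_selector (override_selector a0 Fx) Fy).
  exact: box_override.
by rewrite override_selectorE cylt.
Qed.

Lemma eq_selector_topology tau sigma (a0 : selector F) :
  selector_topology tau = selector_topology sigma <->
  component tau = component sigma.
Proof.
split=> [eq_ts|eq_ts]; last first.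
  by rewrite !selector_topologyE /box_index eq_ts.
by apply/funext => t; apply/seteqP; split; apply: component_le a0 _ _;
  rewrite eq_ts.
Qed.

(** A canonical soft topology is recovered from its components. *)
Lemma eq_canonical_soft_topology tau sigma :
  canonical_soft_topology tau -> canonical_soft_topology sigma ->
  soft_open tau = soft_open sigma <-> component tau = component sigma.
Proof.
move=> ctau csigma; split=> [eq_ts|eq_ts]; first by rewrite /component eq_ts.
by rewrite ctau csigma /canonical_enlargement eq_ts.
Qed.

End SelectorTopology.

Section ConjugateSelectorTopology.
Variables (A : Type) (G : groupType) (F : softGroup A G) (tau : softTopology F).

(** Pointwise [set_inv] exchanges the box indices of the two topologies, and inversion carries each
    box to the inverted one. *)
Lemma selector_topology_conj (O : set (selector F)) :
  selector_topology (conj_topology tau) O <->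
  selector_topology tau ((fun a : selector F => a^-1) @^-1` O).
Proof.
rewrite !selector_topologyP; split=> oO a Oa.
  have [U [oU Ua UO]] := oO _ Oa.
  exists (fun t => set_inv (U t)); split=> [t||b Ub].
  - by have := oU t; rewrite component_conj => -[V oV <-]; rewrite set_invK.
  - by move=> t; rewrite set_invE; exact: Ua t.
  - by apply: UO => t; have := Ub t; rewrite set_invE.
have [|U [oU Ua UO]] := oO a^-1; first by rewrite /= invgK.
exists (fun t => set_inv (U t)); split=> [t||b Ub].
- by rewrite component_conj; exists (U t) => //; exact: oU.
- by move=> t; rewrite set_invE; exact: Ua t.
- rewrite -[b]invgK; apply: (UO b^-1) => t.
  by have := Ub t; rewrite set_invE.
Qed.

Lemma inv_continuous_to_conj :
  continuous ((fun a : selector F => a^-1) :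
    selector_space tau -> selector_space (conj_topology tau)).
Proof. by apply/continuousP => O /selector_topology_conj. Qed.

Lemma inv_continuous_from_conj :
  continuous ((fun a : selector F => a^-1) :
    selector_space (conj_topology tau) -> selector_space tau).
Proof.
apply/continuousP => O oO; apply/selector_topology_conj.
rewrite [X in selector_topology _ X](_ : _ = O) //.
by apply/seteqP; split=> a /=; rewrite invgK.
Qed.

Lemma inv_homeomorphism_conj :
  @homeomorphism (selector_space tau) (selector_space (conj_topology tau))
    (fun a : selector F => a^-1).
Proof.
exists (fun a : selector F => a^-1); split.
- exact: invgK.
- exact: invgK.
- exact: inv_continuous_to_conj.
- exact: inv_continuous_from_conj.
Qed.

Lemma mul_continuous_conj :
  mul_continuous (selector_space tau) ->
  mul_continuous (selector_space (conj_topology tau)).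
Proof.
move=> mulC.
(* Both spaces have carrier [selector F]; the typed aliases fix which topology each map refers
   to. *)
pose X := selector_space tau; pose Y := selector_space (conj_topology tau).
pose to_conj : X -> Y := fun a : selector F => a^-1.
pose from_conj : Y -> X := fun a : selector F => a^-1.
pose swap_inv (p : Y * Y) : X * X := (from_conj p.2, from_conj p.1).
pose mul (p : X * X) : X := p.1 * p.2.
have mulE : (fun p : Y * Y => p.1 * p.2) = to_conj \o (mul \o swap_inv).
  apply/funext => -[a b]; apply: selector_ext => t /=.
  by rewrite invgM !invgK.
rewrite /mul_continuous mulE => p.
apply: continuous_comp; last exact: inv_continuous_to_conj.
apply: continuous_comp; last exact: mulC.
apply: (@cvg_pair _ _ _ (nbhs p)
  (nbhs (from_conj p.2)) (nbhs (from_conj p.1))).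
  by apply: continuous_comp; [exact: cvg_snd | exact: inv_continuous_from_conj].
by apply: continuous_comp; [exact: cvg_fst | exact: inv_continuous_from_conj].
Qed.

Lemma inv_continuous_conj :
  inv_continuous (selector_space tau) ->
  inv_continuous (selector_space (conj_topology tau)).
Proof.
move=> /continuousP invC; apply/continuousP => O.
by move=> /selector_topology_conj/invC oO; apply/selector_topology_conj.
Qed.

Lemma inv_continuous_eq_conj :
  inv_continuous (selector_space tau) <->
  selector_topology tau = selector_topology (conj_topology tau).
Proof.
split=> [/continuousP invC|eq_conj].
  (* A [tau]-open [O] has a [tau]-open inverse, so it is conj-open. Conversely, a conj-open [O] has
     a [tau]-open inverse, and inverting once more returns [O]. *)
  apply/seteqP; split=> O.
    by move=> /invC; exact: (selector_topology_conj O).2.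
  move=> /selector_topology_conj/invC.
  rewrite [X in open X -> _](_ : _ = O) //.
  by apply/seteqP; split=> a /=; rewrite invgK.
apply/continuousP => O oO; apply/(selector_topology_conj O).1.
by rewrite -eq_conj.
Qed.

End ConjugateSelectorTopology.

Theorem theorem4p4 (A : Type) (hA : inhabited A) (G : groupType)
    (F : softGroup A G) (tau : softTopology F)
    (htau : soft_paratopological_group tau) :
  soft_paratopological_group (conj_topology tau) /\
  (mul_continuous (selector_space tau) /\
   mul_continuous (selector_space (conj_topology tau))) /\
  @homeomorphism (selector_space tau) (selector_space (conj_topology tau))
    (fun a : selector F => (a^-1)%g) /\
  (soft_topological_group tau <->
   soft_bitopological_group tau (conj_topology tau)) /\
  (soft_bitopological_group tau (conj_topology tau) <->
   selector_topology tau = selector_topology (conj_topology tau)) /\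
  (canonical_soft_topology tau ->
   (selector_topology tau = selector_topology (conj_topology tau) <->
    soft_open tau = soft_open (conj_topology tau))).
Proof.
have mulC := mul_continuous_conj htau.
have bitop : soft_topological_group tau <->
    soft_bitopological_group tau (conj_topology tau).
  split=> [[_ invC]|[]//].
  by split; split=> //; exact: inv_continuous_conj.
split=> //; split=> //; split; first exact: inv_homeomorphism_conj.
split=> //; split.
  (* As multiplication is continuous by [htau], being a soft topological group reduces to continuity
     of inversion. *)
  rewrite -bitop -inv_continuous_eq_conj.
  by split=> [[]//|invC]; split.
(* Both equalities amount to equality of components; the identity selector serves as base point, and
   the conjugate topology is canonical by construction. *)
move=> ctau; rewrite (eq_selector_topology _ _ (selector_one F)).
by rewrite (eq_canonical_soft_topology ctau (@canonical_conj _ _ _ tau)).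
Qed.
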